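(* Let $1<q\le 2$ and let $\gamma>0$ be a constant. There is a constant $c=c(\gamma,q)$, depending only on $\gamma$ and $q$, such that the following holds. Let $X$ be a real Banach space whose modulus of smoothness satisfies $\rho(u)\le\gamma u^q$ for all $u>0$, let $\mathcal D\subset X$ be a dictionary, let $\{t_k\}_{k=1}^\infty$ be a sequence with $t_k\in(0,1]$ for all $k$, and let $f\in\mathcal A_1(\mathcal D)\subset X$. Then every output $(f_m)_{m\ge0}$ of the Weak Rescaled Pure Greedy Algorithm WRPGA($\{t_k\},\mathcal D$) (run with these parameters $\gamma$ and $q$) applied to $f$ satisfies $$\|f-f_m\|\le c\,|f|_{\mathcal A_1(\mathcal D)}\left(\sum_{k=1}^m t_k^{\frac q{q-1}}\right)^{\frac1q-1},\qquad m\ge1.$$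
   Context: $X$ is a real Banach space with norm $\|\cdot\|$. Its modulus of smoothness is $$\rho(u):=\sup_{f,g\in X,\ \|f\|=\|g\|=1}\left\{\tfrac12(\|f+ug\|+\|f-ug\|)-1\right\},\quad u>0.$$ For $f\in X$, $f\ne0$, $F_f\in X^*$ denotes a norming functional of $f$: $\|F_f\|=1$ and $F_f(f)=\|f\|$. Dictionary: a set $\mathcal D\subset X$ with $\|\varphi\|=1$ for every $\varphi\in\mathcal D$ such that the closure of $\mathrm{span}(\mathcal D)$ is $X$. For $M>0$ let $\mathcal A_1^{o}(\mathcal D,M)$ be the set of all finite sums $\sum_{k\in\Lambda}c_k\varphi_k$ with $\varphi_k\in\mathcal D$, $|\Lambda|<\infty$ and $\sum_{k\in\Lambda}|c_k|\le M$, and let $\mathcal A_1(\mathcal D,M)$ be its closure in $X$. Put $\mathcal A_1(\mathcal D)=\bigcup_{M>0}\mathcal A_1(\mathcal D,M)$ and, for $f\in\mathcal A_1(\mathcal D)$, $|f|_{\mathcal A_1(\mathcal D)}=\inf\{M: f\in\mathcal A_1(\mathcal D,M)\}$. WRPGA($\{t_k\},\mathcal D$) in $X$, applied to $f$, produces a sequence $(f_m)_{m\ge0}$ as follows. Step 0: $f_0:=0$. Step $m\ge1$: if $f_{m-1}=f$, the algorithm stops and $f_k:=f$ for all $k\ge m$. If $f_{m-1}\ne f$, choose $\varphi_m\in\mathcal D$ such that $$|F_{f-f_{m-1}}(\varphi_m)|\ge t_m\sup_{\varphi\in\mathcal D}|F_{f-f_{m-1}}(\varphi)|$$ (it is assumed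 that such a choice exists at each step; it need not be unique), and set $$\lambda_m:=\mathrm{sign}\{F_{f-f_{m-1}}(\varphi_m)\}\,\|f-f_{m-1}\|\,(2\gamma q)^{\frac1{1-q}}\,|F_{f-f_{m-1}}(\varphi_m)|^{\frac1{q-1}},\qquad \hat f_m:=f_{m-1}+\lambda_m\varphi_m.$$ Choose $s_m\in\mathbb R$ such that $\|f-s_m\hat f_m\|=\min_{s\in\mathbb R}\|f-s\hat f_m\|$ and put $f_m:=s_m\hat f_m$. *)

(* Defs.v *)
From HB Require Import structures.
From mathcomp Require Import all_boot all_order all_algebra.
From mathcomp Require Import all_classical all_reals all_analysis.
Import Order.TTheory GRing.Theory Num.Theory.
Import numFieldNormedType.Exports.

Set Implicit Arguments.
Unset Strict Implicit.
Unset Printing Implicit Defensive.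

Local Open Scope classical_set_scope.
Local Open Scope ring_scope.

(* For u > 0 the set is bounded above by u, so the real-valued [sup] is the
   genuine supremum; it is empty only when X = {0}, where [sup set0 = 0]. *)
Definition smoothness_modulus (R : realType) (X : normedModType R) (u : R) : R :=
  sup [set s | exists f g : X, [/\ `|f| = 1, `|g| = 1 &
         s = (`|f + u *: g| + `|f - u *: g|) / 2 - 1]].

(* Meaningful for continuous F only: an unbounded F would get the value 0. *)
Definition dual_norm (R : realType) (X : normedModType R)
    (F : {linear X -> R^o}) : R :=
  sup [set `|F x : R| | x in [set x : X | `|x| <= 1]].

Definition norming_functional (R : realType) (X : normedModType R) (f : X)
    (F : {linear X -> R^o}) : Prop :=
  [/\ continuous (F : X -> R^o), dual_norm F = 1 & F f = `|f|].

Definition linear_span (R : realType) (X : normedModType R) (D : set X) : set X :=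
  [set x | exists (n : nat) (c : 'I_n -> R) (phi : 'I_n -> X),
     (forall k, D (phi k)) /\ x = \sum_(k < n) c k *: phi k].

Definition dictionary (R : realType) (X : normedModType R) (D : set X) : Prop :=
  (forall phi, D phi -> `|phi| = 1) /\ closure (linear_span D) = setT.

Definition A1o (R : realType) (X : normedModType R) (D : set X) (M : R) : set X :=
  [set x | exists (n : nat) (c : 'I_n -> R) (phi : 'I_n -> X),
     [/\ forall k, D (phi k), \sum_(k < n) `|c k| <= M &
         x = \sum_(k < n) c k *: phi k]].

Definition A1_le (R : realType) (X : normedModType R) (D : set X) (M : R) : set X :=
  closure (A1o D M).

Definition A1 (R : realType) (X : normedModType R) (D : set X) : set X :=
  \bigcup_(M in [set M : R | 0 < M]) A1_le D M.

Definition A1_norm (R : realType) (X : normedModType R) (D : set X) (f : X) : R :=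
  inf [set M : R | 0 < M /\ A1_le D M f].

Definition WRPGA_lambda (R : realType) (X : normedModType R) (gamma q : R)
    (F : {linear X -> R^o}) (r phi : X) : R :=
  Num.sg (F phi : R) * `|r| * (2 * gamma * q) `^ (1 / (1 - q))
    * `|F phi : R| `^ (1 / (q - 1)).

(* One step from f_{m-1} = [g] to f_m = [g'] with weakness parameter [tm]. The
   norming functional of the residual, the element of D and the line-search
   minimizer may be any admissible ones, so this is a relation. *)
Definition WRPGA_step (R : realType) (X : normedModType R) (gamma q : R)
    (D : set X) (f : X) (tm : R) (g g' : X) : Prop :=
  (g = f -> g' = f) /\
  (g <> f ->
   exists (F : {linear X -> R^o}) (phi : X) (s : R),
     let fhat := g + WRPGA_lambda gamma q F (f - g) phi *: phi in
     [/\ norming_functional (f - g) F,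
         D phi,
         tm * sup [set `|F psi : R| | psi in D] <= `|F phi : R|,
         forall s' : R, `|f - s *: fhat| <= `|f - s' *: fhat| &
         g' = s *: fhat]).

(* Stopping is encoded in the step: once f_{m-1} = f, the value f is kept
   forever. The value t 0 is never used. *)
Definition WRPGA_output (R : realType) (X : normedModType R) (gamma q : R)
    (t : nat -> R) (D : set X) (f : X) (f_ : nat -> X) : Prop :=
  f_ 0%N = 0 /\
  forall m : nat, (1 <= m)%N ->
    WRPGA_step gamma q D f (t m) (f_ m.-1) (f_ m).

(* Main.v *)
(** Let a_m be the norm of f - f_m and p = q / (q - 1). Smoothness bounds the
    norm of a perturbed residual by its linearization plus a term of order q.
    First, this makes the norming functional F of the residual vanish at
    f_{m-1}, because f_{m-1} is a best approximation of f on its own line;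
    hence a_{m-1} = F f, which is at most M times the supremum of |F| over the
    dictionary when f lies in A_1(D, M). Second, the prescribed step length
    gives a_m <= a_{m-1} (1 - C (t_m a_{m-1} / M)^p). This recurrence forces
    a_m^p C M^{-p} (t_1^p + ... + t_m^p) <= 1, and one takes the infimum
    over M. *)

Require Import Defs.
From HB Require Import structures.
From mathcomp Require Import all_boot all_order all_algebra.
From mathcomp Require Import all_classical all_reals all_analysis.
From mathcomp Require Import ring lra.
Import Order.TTheory GRing.Theory Num.Theory.
Import numFieldNormedType.Exports.
Local Open Scope classical_set_scope.
Local Open Scope ring_scope.

(** * Consequences of smoothness for norming functionals *)

Lemma smoothness_modulus_ge (R : realType) (X : normedModType R) (u : R)
    (f g : X) :
  0 < u -> `|f| = 1 -> `|g| = 1 ->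
  (`|f + u *: g| + `|f - u *: g|) / 2 - 1 <= smoothness_modulus X u.
Proof.
move=> u0 f1 g1; apply: ub_le_sup; last by exists f, g.
exists u => _ [f' [g' [f'1 g'1 ->]]].
have hp := ler_normD f' (u *: g').
have hm := ler_normB f' (u *: g').
rewrite !normrZ !f'1 !g'1 (gtr0_norm u0) mulr1 in hp hm.
lra.
Qed.

(** Homogeneity reduces this to unit vectors with [u = |y| / |x|]; the case [y = 0] is separate
    because the modulus is controlled only for [u > 0]. *)
Lemma norm_symmetric_sum_le (R : realType) (q gamma : R)
    (X : normedModType R) (x y : X) :
  0 <= gamma ->
  (forall u : R, 0 < u -> smoothness_modulus X u <= gamma * u `^ q) ->
  x != 0 ->
  `|x + y| + `|x - y| <= 2 * `|x| * (1 + gamma * (`|y| / `|x|) `^ q).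
Proof.
move=> g0 hX x0.
have nx : 0 < `|x| by rewrite normr_gt0.
have [->|y0] := eqVneq y 0.
  rewrite addr0 subr0 normr0 mul0r.
  have : 0 <= `|x| * (gamma * 0 `^ q) by rewrite !mulr_ge0 ?powR_ge0.
  lra.
have ny : 0 < `|y| by rewrite normr_gt0.
pose u := `|y| / `|x|; rewrite -/u.
have u0 : 0 < u by rewrite divr_gt0.
pose x' := `|x|^-1 *: x; pose y' := `|y|^-1 *: y.
have x'1 : `|x'| = 1 by rewrite normrZ normfV normr_id mulVf ?gt_eqF.
have y'1 : `|y'| = 1 by rewrite normrZ normfV normr_id mulVf ?gt_eqF.
have xE : x = `|x| *: x' by rewrite scalerA divff ?gt_eqF ?scale1r.
have yE : y = `|x| *: (u *: y').
  by rewrite !scalerA /u mulrCA divff ?gt_eqF // mulr1 divff ?gt_eqF ?scale1r.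
have -> : `|x + y| = `|x| * `|x' + u *: y'|.
  by rewrite -[in RHS](normr_id x) -normrZ scalerDr -xE -yE.
have -> : `|x - y| = `|x| * `|x' - u *: y'|.
  by rewrite -[in RHS](normr_id x) -normrZ scalerBr -xE -yE.
rewrite -mulrDr [2 * _]mulrC -mulrA ler_pM2l //.
have := le_trans (smoothness_modulus_ge _ _ u _ _ u0 x'1 y'1) (hX _ u0).
lra.
Qed.

Lemma norming_functional_le (R : realType) (X : normedModType R) (r : X)
    (F : {linear X -> R^o}) (x : X) :
  norming_functional r F -> `|F x : R| <= `|x|.
Proof.
move=> [_ F1 _].
(* [sup] defaults to 0 where no supremum exists, so [dual_norm F = 1] already forces boundedness on
   the unit ball. *)
have hs : has_sup [set `|F x : R| | x in [set x : X | `|x| <= 1]].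
  apply: contrapT => /sup_out; rewrite -/(dual_norm F) F1 => /eqP.
  by rewrite oner_eq0.
have [->|x0] := eqVneq x 0; first by rewrite linear0 !normr0.
have nx : 0 < `|x| by rewrite normr_gt0.
have : `|F (`|x|^-1 *: x) : R| <= 1.
  rewrite -F1; apply: sup_upper_bound => //; exists (`|x|^-1 *: x) => //=.
  by rewrite normrZ normfV normr_id mulVf ?gt_eqF.
rewrite linearZ /= normrM normfV normr_id.
by rewrite mulrC ler_pdivrMr // mul1r.
Qed.

(** Since [|x + y|] is at least [F (x + y) = |x| + F y], the symmetric bound leaves this much for
    [|x - y|]. *)
Lemma norm_sub_le (R : realType) (q gamma : R)
    (X : normedModType R) (x y : X) (F : {linear X -> R^o}) :
  0 <= gamma ->
  (forall u : R, 0 < u -> smoothness_modulus X u <= gamma * u `^ q) ->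
  x != 0 -> norming_functional x F ->
  `|x - y| <= `|x| - F y + 2 * gamma * `|x| * (`|y| / `|x|) `^ q.
Proof.
move=> g0 hX x0 hF.
have h1 := norm_symmetric_sum_le _ q gamma _ x y g0 hX x0.
have h2 := le_trans (ler_norm _) (norming_functional_le _ _ _ _ (x + y) hF).
case: hF => _ _ Fx; rewrite linearD Fx in h2.
have {}h2 : `|x| + (F y : R) <= `|x + y| by [].
suff : `|x - y| + (F y : R) <= `|x| + 2 * gamma * `|x| * (`|y| / `|x|) `^ q.
  by rewrite -lerBrDr addrAC.
lra.
Qed.

(** If [F y] were nonzero, a move of size [v] with its sign would gain [v |F y|] and cost only
    [O(v ^ q)]; as [q > 1], a small [v] would beat the minimum. *)
Lemma norming_functional_line_min (R : realType) (q gamma : R)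
    (X : normedModType R) (x y : X) (F : {linear X -> R^o}) :
  1 < q -> 0 <= gamma ->
  (forall u : R, 0 < u -> smoothness_modulus X u <= gamma * u `^ q) ->
  x != 0 -> norming_functional x F ->
  (forall u : R, `|x| <= `|x - u *: y|) ->
  F y = 0.
Proof.
move=> q1 g0 hX x0 hF hmin.
set d : R := F y; apply/eqP; apply: contrapT => /negP d0.
have nx : 0 < `|x| by rewrite normr_gt0.
pose K := 2 * gamma * `|x| * (`|y| / `|x|) `^ q.
have K0 : 0 <= K by rewrite !mulr_ge0 ?powR_ge0.
have nd : 0 < `|d| by rewrite normr_gt0.
have hv v : 0 < v -> v * `|d| <= K * (v * v `^ (q - 1)).
  move=> v0.
  have h := norm_sub_le _ q gamma _ x ((Num.sg d * v) *: y) F g0 hX x0 hF.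
  have {h} := le_trans (hmin _) h.
  rewrite linearZ /= -/d normrZ normrM normr_sg d0 mul1r (gtr0_norm v0).
  rewrite mulr_powRB1 ?(ltW v0) //; last lra.
  rewrite -(mulrA v) powRM ?(ltW v0) ?divr_ge0 //.
  have -> : ((Num.sg d * v) *: d)%R = v * `|d|.
    by rewrite /GRing.scale /= mulrAC -normrEsg mulrC.
  by rewrite /K => h; lra.
(* Chosen so that [K * v ^ (q - 1) = |d| * K / (K + 1) < |d|]. *)
pose v := (`|d| / (K + 1)) `^ (q - 1)^-1.
have v0 : 0 < v by rewrite powR_gt0 // divr_gt0 // ltr_wpDl.
have := hv _ v0; rewrite mulrCA ler_pM2l //.
rewrite /v -powRrM mulVf ?subr_eq0 ?gt_eqF // powRr1; last first.
  by rewrite divr_ge0 // addr_ge0.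
rewrite mulrA ler_pdivlMr ?ltr_wpDl // [K * _]mulrC ler_pM2l //.
lra.
Qed.

(** * One step of the algorithm *)

Definition contraction_const (R : realType) (q gamma : R) : R :=
  (q - 1) / q * (2 * gamma * q) `^ (1 / (1 - q)).

Lemma contraction_const_gt0 (R : realType) (q gamma : R) :
  1 < q -> 0 < gamma -> 0 < contraction_const R q gamma.
Proof.
move=> q1 g0; have q0 : 0 < q by lra.
by rewrite mulr_gt0 ?divr_gt0 ?subr_gt0 ?powR_gt0 ?mulr_gt0.
Qed.

(* The step length minimizes [- h mu + 2 gamma mu ^ q] over [mu]. *)
Lemma greedy_step_contraction (R : realType) (q gamma : R)
    (X : normedModType R) (r phi : X) (F : {linear X -> R^o}) :
  1 < q -> 0 < gamma ->
  (forall u : R, 0 < u -> smoothness_modulus X u <= gamma * u `^ q) ->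
  r != 0 -> norming_functional r F -> `|phi| = 1 ->
  `|r - WRPGA_lambda gamma q F r phi *: phi| <=
    `|r| * (1 - contraction_const R q gamma * `|F phi : R| `^ (q / (q - 1))).
Proof.
move=> q1 g0 hX r0 hF phi1.
have q0 : 0 < q by lra.
have nr : 0 < `|r| by rewrite normr_gt0.
have q1n0 : q - 1 != 0 by rewrite gt_eqF // subr_gt0.
have q1n0' : 1 - q != 0 by rewrite lt_eqF // subr_lt0.
set d : R := F phi.
have [d0|d0] := eqVneq d 0.
  rewrite /WRPGA_lambda -/d d0 sgr0 !mul0r scale0r subr0 normr0 powR0.
    by rewrite mulr0 subr0 mulr1.
  by rewrite mulf_neq0 ?invr_eq0 // gt_eqF.
have h0 : 0 < `|d| by rewrite normr_gt0.
apply: le_trans (norm_sub_le _ q gamma _ r _ F (ltW g0) hX r0 hF) _.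
rewrite linearZ /= -/d /WRPGA_lambda -/d normrZ phi1 mulr1.
set A := (2 * gamma * q) `^ (1 / (1 - q)); set B := `|d| `^ (1 / (q - 1)).
have A0 : 0 <= A by exact: powR_ge0.
have B0 : 0 <= B by exact: powR_ge0.
have k0 : 0 < 2 * gamma * q by rewrite !mulr_gt0.
(* Because of this identity the order [q] term is exactly [1 / q] of the linear gain, which leaves
   the factor [(q - 1) / q] in the contraction constant. *)
have Aq : A `^ q = A / (2 * gamma * q).
  rewrite /A -powRrM -[in RHS](powR_inv1 (ltW k0)) -powRD; last first.
    by rewrite (gt_eqF k0) implybT.
  by congr (_ `^ _); field.
have Bq : B `^ q = `|d| `^ (q / (q - 1)).
  by rewrite /B -powRrM; congr (_ `^ _); field.
have Bh : B * `|d| = `|d| `^ (q / (q - 1)).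
  rewrite /B -[X in _ * X = _](powRr1 (ltW h0)) -powRD; last first.
    by rewrite (gt_eqF h0) implybT.
  by congr (_ `^ _); field.
have -> : `|Num.sg d * `|r| * A * B| / `|r| = A * B.
  rewrite !normrM normr_sg d0 mul1r normr_id (ger0_norm A0) (ger0_norm B0).
  by field; rewrite gt_eqF.
rewrite powRM // Aq Bq.
have -> : ((Num.sg d * `|r| * A * B) *: d : R^o) = `|r| * A * (B * `|d|).
  by rewrite /GRing.scale /= [in RHS]normrEsg; ring.
rewrite Bh /contraction_const -/A; set P := _ `^ (q / _).
rewrite le_eqVlt; apply/orP; left; apply/eqP.
by change (`|r| - `|r| * A * P + 2 * gamma * `|r| * (A / (2 * gamma * q) * P)
  = `|r| * (1 - (q - 1) / q * A * P) :> R); field; rewrite !gt_eqF.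
Qed.

(** Finite sums satisfy the bound term by term, and it passes to the closure because [F] is
    1-Lipschitz. *)
Lemma A1_le_dual (R : realType) (X : normedModType R) (D : set X) (M : R)
    (r f : X) (F : {linear X -> R^o}) :
  (forall phi, D phi -> `|phi| = 1) -> norming_functional r F ->
  A1_le D M f -> (F f : R) <= M * sup [set `|F psi : R| | psi in D].
Proof.
move=> hD hF hf; set K := sup _.
have FK psi : D psi -> `|F psi : R| <= K.
  move=> Dpsi; apply: ub_le_sup; last by exists psi.
  exists 1 => _ [x Dx <-].
  by rewrite -(hD _ Dx); exact: norming_functional_le hF.
have K0 : 0 <= K.
  have [[psi Dpsi]|/set0P/negP/negPn/eqP D0] := pselect (D !=set0).
    exact: le_trans (FK _ Dpsi).
  by rewrite /K D0 image_set0 sup0.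
apply/ler_addgt0Pr => e e0.
have [_ [[n [c [phi [Dphi hc ->]]]] hb]] := hf _ (nbhsx_ballx f e e0).
set x := \sum_(k < n) _ in hb.
have hx : (F x : R) <= M * K.
  apply: le_trans (ler_wpM2r K0 hc).
  rewrite /x linear_sum mulr_suml; apply: ler_sum => k _.
  rewrite linearZ /=; apply: le_trans (ler_norm _) _.
  by rewrite normrM ler_wpM2l // FK.
have hfx : (F f : R) - (F x : R) <= e.
  rewrite -[X in X <= _]/(F f - F x) -linearB.
  apply: le_trans (ler_norm _) _.
  apply: le_trans (norming_functional_le _ _ _ _ _ hF) _.
  by move: hb; rewrite -ball_normE /= => /ltW.
lra.
Qed.

(* The minimum over the line through the new iterate annihilates it under the
   norming functional of the residual, whence [`|f - g| = F f]. *)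
Lemma WRPGA_step_contraction (R : realType) (q gamma : R)
    (X : normedModType R) (D : set X) (M tm : R) (f g g' : X) :
  1 < q -> 0 < gamma ->
  (forall u : R, 0 < u -> smoothness_modulus X u <= gamma * u `^ q) ->
  (forall phi, D phi -> `|phi| = 1) ->
  0 < M -> A1_le D M f -> 0 <= tm ->
  (forall s : R, `|f - g| <= `|f - s *: g|) ->
  WRPGA_step gamma q D f tm g g' ->
  `|f - g'| <= `|f - g| *
     (1 - contraction_const R q gamma * (tm / M * `|f - g|) `^ (q / (q - 1)))
  /\ forall s : R, `|f - g'| <= `|f - s *: g'|.
Proof.
move=> q1 g0 hX hD M0 hf tm0 hmin [hstop hstep].
have [fg|fg] := eqVneq g f.
  rewrite (hstop fg) fg subrr normr0 mul0r; split => // s.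
have [F [phi [s /= [hF Dphi hphi hs ->]]]] := hstep (elimN eqP fg).
(* Multiples of the new iterate are multiples of [fhat], so the line minimality is inherited by the
   next step. *)
split; last by move=> s'; rewrite scalerA; exact: hs.
have r0 : f - g != 0 by rewrite subr_eq0 eq_sym.
have Fg : F g = 0.
  apply: (norming_functional_line_min _ q gamma _ _ _ _ q1 (ltW g0) hX r0 hF).
  by move=> u; rewrite -addrA -opprD -[X in X + u *: _]scale1r -scalerDl.
have Ff : `|f - g| <= M * sup [set `|F psi : R| | psi in D].
  have := A1_le_dual _ _ _ _ _ _ _ hD hF hf.
  by case: (hF) => _ _ <-; rewrite linearB Fg subr0.
(* Taking [s' = 1] compares the rescaled iterate with the unrescaled one. *)
apply: le_trans (hs 1) _; rewrite scale1r opprD addrA.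
apply: le_trans
  (greedy_step_contraction _ q gamma _ _ _ F q1 g0 hX r0 hF (hD _ Dphi)) _.
rewrite ler_wpM2l // lerD2l lerN2 ler_wpM2l //.
  exact/ltW/contraction_const_gt0.
have p0 : 0 <= q / (q - 1) by rewrite divr_ge0 //; lra.
apply: (ge0_ler_powR p0).
- by rewrite nnegrE !mulr_ge0 ?invr_ge0 ?(ltW M0).
- by rewrite nnegrE.
- apply: le_trans hphi; rewrite -mulrA ler_wpM2l //.
  by rewrite ler_pdivrMl.
Qed.

(** * From the recurrence to the rate *)

Lemma recurrence_bound (R : realType) (p : R) (a tau : nat -> R) :
  1 <= p -> (forall k, 0 <= a k) -> (forall k, 0 <= tau k) ->
  (forall k, a k.+1 <= a k * (1 - tau k * a k `^ p)) ->
  forall m, (\sum_(0 <= k < m) tau k) * a m `^ p <= 1.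
Proof.
move=> p1 a0 tau0 ha; elim => [|m IH]; first by rewrite big_geq // mul0r.
rewrite big_nat_recr //=.
set S := \sum_(_ <= _ < _) _ in IH *.
have S0 : 0 <= S by exact: sumr_ge0.
have [am0|am0] := eqVneq (a m) 0.
  have -> : a m.+1 = 0.
    by apply: le_anti; rewrite a0 andbT; have := ha m; rewrite am0 mul0r.
  by rewrite powR0 ?mulr0 // gt_eqF //; lra.
have am : 0 < a m by rewrite lt_def am0 a0.
have := ha m; set b := a m `^ p in IH *; set x := 1 - _ => hx.
have b0 : 0 <= b by exact: powR_ge0.
have x0 : 0 <= x by rewrite -(pmulr_rge0 _ am) (le_trans (a0 _) hx).
have x1 : x <= 1 by rewrite /x lerBlDr lerDl mulr_ge0.
(* The factor [x] lies in [0, 1] and [p >= 1], so [x ^ p <= x]. *)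
have hb : a m.+1 `^ p <= b * x.
  have p0 : 0 <= p by lra.
  have hax : 0 <= a m * x by rewrite mulr_ge0 ?(ltW am).
  apply: le_trans (ge0_ler_powR p0 _ _ hx) _; rewrite ?nnegrE //.
  rewrite powRM ?(ltW am) // ler_wpM2l //.
  have [->|xn0] := eqVneq x 0; first by rewrite powR0 // gt_eqF //; lra.
  by apply: ge1r_powR => //; rewrite x1 lt_def xn0 x0.
(* With [y = tau m * b], the induction hypothesis gives the bound
   [(1 - y) + y (1 - y) = 1 - y ^ 2 <= 1]. *)
apply: le_trans (ler_wpM2l (addr_ge0 S0 (tau0 m)) hb) _.
have : S * b * x <= x by rewrite ler_piMl.
rewrite /x; set y := tau m * b.
have y0 : 0 <= y by rewrite mulr_ge0.
have -> : (S + tau m) * (b * (1 - y)) = S * b * (1 - y) + y * (1 - y).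
  by rewrite /y; ring.
have : 0 <= y * y by rewrite mulr_ge0.
lra.
Qed.

Theorem theorem6p1 (R : realType) (q gamma : R)
    (hq : 1 < q <= 2) (hgamma : 0 < gamma) :
  exists c : R,
  forall (X : completeNormedModType R)
    (hX : forall u : R, 0 < u -> smoothness_modulus X u <= gamma * u `^ q)
    (D : set X) (hD : dictionary D)
    (t : nat -> R) (ht : forall k : nat, (1 <= k)%N -> 0 < t k <= 1)
    (f : X) (hf : A1 D f)
    (f_ : nat -> X) (hf_ : WRPGA_output gamma q t D f f_)
    (m : nat) (hm : (1 <= m)%N),
  `|f - f_ m| <= c * A1_norm D f *
    (\sum_(1 <= k < m.+1) t k `^ (q / (q - 1))) `^ (1 / q - 1).
Proof.
have /andP[q1 _] := hq.
have C0 := contraction_const_gt0 _ q gamma q1 hgamma.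
set C := contraction_const _ _ _ in C0.
(* The exponent is [- 1 / p]: the constant comes from solving [C M^(-p) S a^p <= 1] for [a]. *)
exists (C `^ (1 / q - 1)) => X hX D [hD _] t ht f [M' /= M'0 hM'] f_.
move=> [f00 hstep] m hm.
pose p := q / (q - 1).
have q10 : 0 < q - 1 by lra.
have q0 : 0 < q by lra.
have p1 : 1 <= p by rewrite ler_pdivlMr //; lra.
have pp : 0 < p by lra.
have pE : 1 / q - 1 = - p^-1 by rewrite /p; field; rewrite !gt_eqF.
set S := \sum_(_ <= _ < _) _.
have t0 k : 0 < t k.+1 by have /andP[] := ht k.+1 isT.
have S0 : 0 < S.
  rewrite /S big_add1 /= -(prednK hm) big_nat_recl // ltr_wpDr ?powR_gt0 //.
  by apply: sumr_ge0 => k _; exact: powR_ge0.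
(* Isolating [A1_norm] turns the goal into a lower bound for an infimum, so it suffices to treat
   each admissible [M]. *)
rewrite mulrAC mulrC -ler_pdivrMr ?mulr_gt0 ?powR_gt0 //.
apply: lb_le_inf; first by exists M'.
move=> M [M0 hM]; rewrite ler_pdivrMr ?mulr_gt0 ?powR_gt0 //.
(* The invariant starts trivially: [f_ 0 = 0] makes its line a single point. *)
have hmin k s : `|f - f_ k| <= `|f - s *: f_ k|.
  elim: k s => [|k IH] s; first by rewrite f00 scaler0.
  by have [_] := WRPGA_step_contraction _ q gamma _ _ M _ _ _ _
    q1 hgamma hX hD M0 hM (ltW (t0 k)) IH (hstep k.+1 isT).
(* The index is shifted: passing from [f_ k] to [f_ k.+1] uses [t k.+1]. *)
pose tau k := C * M `^ (- p) * t k.+1 `^ p.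
have ha k : `|f - f_ k.+1| <= `|f - f_ k| * (1 - tau k * `|f - f_ k| `^ p).
  have [h _] := WRPGA_step_contraction _ q gamma _ _ M _ _ _ _
    q1 hgamma hX hD M0 hM (ltW (t0 k)) (hmin k) (hstep k.+1 isT).
  apply: le_trans h _; rewrite -/C -/p powRM ?divr_ge0 ?(ltW M0) ?(ltW (t0 k)) //.
  rewrite powRM ?invr_ge0 ?(ltW M0) ?(ltW (t0 k)) //.
  rewrite -(powR_inv1 (ltW M0)) -powRrM mulN1r /tau.
  by rewrite le_eqVlt; apply/orP; left; apply/eqP; ring.
have tau0 k : 0 <= tau k
  by apply/mulr_ge0/powR_ge0/mulr_ge0/powR_ge0/ltW.
have := recurrence_bound _ _ _ _ p1 (fun k => normr_ge0 (f - f_ k)) tau0 ha m.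
have <- : C * M `^ (- p) * S = \sum_(0 <= k < m) tau k.
  by rewrite /S big_add1 mulr_sumr.
set a := `|_| => hS.
have a0 : 0 <= a by exact: normr_ge0.
(* The coefficient is a power [(Z * M) ^ (- p)], so [a > Z * M] would contradict [hS] by
   monotonicity of the [p]-th power. *)
have E : C * M `^ (- p) * S = ((C `^ (- p^-1)) * S `^ (- p^-1) * M) `^ (- p).
  have CS0 := mulr_ge0 (powR_ge0 C (- p^-1)) (powR_ge0 S (- p^-1)).
  rewrite (powRM _ CS0 (ltW M0)) (powRM _ (powR_ge0 _ _) (powR_ge0 _ _)).
  rewrite -!powRrM mulrNN mulVf ?gt_eqF // (powRr1 (ltW C0)) (powRr1 (ltW S0)).
  by rewrite mulrAC.
rewrite pE; set Z := C `^ _ * _; have Z0 : 0 < Z by rewrite mulr_gt0 ?powR_gt0.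
rewrite leNgt; apply/negP => lt.
move: hS; rewrite leNgt E -/Z powRN => /negP; apply.
rewrite ltr_pdivlMl ?mulr1; last by rewrite powR_gt0 // (mulr_gt0 Z0 M0).
apply: (gt0_ltr_powR pp).
- by rewrite nnegrE (mulr_ge0 (ltW Z0) (ltW M0)).
- by rewrite nnegrE.
- by rewrite mulrC.
Qed.
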